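(* Let $\alpha=\{k_1,\dots,k_p\}$ be a partition of $N$ with $p\ge 2$. The dual of $\mathcal{FW}_{\alpha,2}^N$ with respect to the trace inner product is $$(\mathcal{FW}_{\alpha,2}^N)^\ast=\{Z\in\mathbb S^N \mid E_{ij}ZE_{ij}^T\in\mathbb S_+^{k_i+k_j}\ \ \forall\, 1\le i<j\le p\}.$$ Furthermore, let $\beta=\{\widetilde k_1,\dots,\widetilde k_q\}$ be a partition of $N$ with $\alpha\sqsupseteq\beta$ (i.e. $\beta$ is a sub-partition of $\alpha$), let $\mathbf 1=\{1,\dots,1\}$ be the partition of $N$ into $N$ ones, and let $K_1,K_2$ be positive integers with $K_1+K_2=N$. Then $$(\mathcal{FW}_{\mathbf 1,2}^N)^\ast\supset(\mathcal{FW}_{\beta,2}^N)^\ast\supset(\mathcal{FW}_{\alpha,2}^N)^\ast\supset(\mathcal{FW}^N_{\mathbf 1,\max_{i\ne j}\{k_i+k_j\}})^\ast\supset(\mathcal{FW}^N_{\{K_1,K_2\},2})^\ast=\mathbb S_+^N,$$ where $\supset$ denotes (not necessarily strict) inclusion.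
   Context: $\mathbb S^n$ denotes the real symmetric $n\times n$ matrices and $\mathbb S^n_+$ the positive semidefinite ones. For a set $\mathcal K\subset\mathbb S^N$, its dual with respect to the trace inner product is $\mathcal K^\ast=\{Z\in\mathbb S^N\mid \operatorname{trace}(XZ)\ge0\ \ \forall X\in\mathcal K\}$. Partitions. A partition $\alpha=\{k_1,\dots,k_p\}$ of $N$ is an ordered list of positive integers with $\sum_{i=1}^p k_i=N$. For such $\alpha$, let $E_i=\begin{bmatrix}0&\cdots&I_{k_i}&\cdots&0\end{bmatrix}\in\mathbb R^{k_i\times N}$ be the $i$-th block row of the $N\times N$ identity matrix partitioned according to $\alpha$, and for $i\ne j$ let $E_{ij}=\begin{bmatrix}E_i^T& E_j^T\end{bmatrix}^T\in\mathbb R^{(k_i+k_j)\times N}$. Sub-partitions. For partitions $\alpha=\{k_1,\dots,k_{p_1}\}$ and $\beta=\{l_1,\dots,l_{p_2}\}$ of the same $N$ with $p_1<p_2$, write $\alpha\sqsupseteq\beta$ ($\beta$ is a sub-partition of $\alpha$) if there are integers $1=m_1<m_2<\dots<m_{p_1+1}=p_2+1$ such that $k_i=\sum_{j=m_i}^{m_{i+1}-1} l_j$ for $i=1,\dots,p_1$. For example $\{4,2\}\sqsupseteq\{2,2,2\}\sqsupseteq\{1,1,1,1,1,1\}$. Factor-width-$k$ matrices. $\mathcal{FW}_k^N$ (also written $\mathcal{FW}_{\mathbf 1,k}^N$) is the set of matrices $X=\sum_{S} e_S^T X_S e_S$, where $S$ ranges over the $\binom Nk$ subsets of $\{1,\dots,N\}$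 of size $k$, $e_S\in\mathbb R^{k\times N}$ is the matrix whose rows are the standard basis row vectors indexed by $S$ (in increasing order), and $X_S\in\mathbb S_+^k$. Block factor-width-two matrices. For a partition $\alpha=\{k_1,\dots,k_p\}$ of $N$, $\mathcal{FW}_{\alpha,2}^N$ is the set of matrices $X\in\mathbb S^N$ of the form $X=\sum_{i=1}^{p-1}\sum_{j=i+1}^p E_{ij}^TX_{ij}E_{ij}$ with $X_{ij}\in\mathbb S_+^{k_i+k_j}$. *)

(* Defs.v *)
From HB Require Import structures.
From mathcomp Require Import all_boot all_order all_algebra.
From mathcomp Require Import all_classical reals.

Set Implicit Arguments.
Unset Strict Implicit.
Unset Printing Implicit Defensive.

Import Order.TTheory GRing.Theory Num.Theory.

Local Open Scope classical_set_scope.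
Local Open Scope ring_scope.

(* S^n and S^n_+; the entry (0, 0) is the scalar of a 1 x 1 matrix. *)
Definition Sym (R : realType) (n : nat) : set 'M[R]_n :=
  [set A | A \is symmetricmx].
Arguments Sym : clear implicits.

Definition PSD (R : realType) (n : nat) : set 'M[R]_n :=
  [set A | Sym R n A /\ forall x : 'cV[R]_n, 0 <= (x^T *m A *m x) 0 0].
Arguments PSD : clear implicits.

Definition dual_cone (R : realType) (N : nat) (K : set 'M[R]_N) : set 'M[R]_N :=
  [set Z | Sym R N Z /\ forall X, K X -> 0 <= \tr (X *m Z)].

(* Partitions are ordered; blocks are indexed from 0, so that block i of alpha
   has size part alpha i and starts at row part_offset alpha i. *)
Definition is_partition (N : nat) (alpha : seq nat) : Prop :=
  all (fun k => 0 < k)%N alpha /\ sumn alpha = N.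

Definition part (alpha : seq nat) (i : nat) : nat := nth 0%N alpha i.

Definition part_offset (alpha : seq nat) (i : nat) : nat := sumn (take i alpha).

Definition part_ones (N : nat) : seq nat := nseq N 1%N.

(* The cut points m start at 0 and end at size beta (instead of 1 and
   size beta + 1). The number of blocks increases strictly. *)
Definition is_subpartition (alpha beta : seq nat) : Prop :=
  (size alpha < size beta)%N /\
  exists m : nat -> nat,
    [/\ m 0%N = 0%N,
        m (size alpha) = size beta,
        forall i, (i < size alpha)%N -> (m i < m i.+1)%N
      & forall i, (i < size alpha)%N ->
          part alpha i = (\sum_(m i <= j < m i.+1) part beta j)%N].

Definition blockE (R : realType) (N : nat) (alpha : seq nat) (i : nat) :
    'M[R]_(part alpha i, N) :=
  \matrix_(a < part alpha i, b < N) ((part_offset alpha i + a)%N == b)%:R.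
Arguments blockE : clear implicits.

Definition blockE2 (R : realType) (N : nat) (alpha : seq nat) (i j : nat) :
    'M[R]_(part alpha i + part alpha j, N) :=
  col_mx (blockE R N alpha i) (blockE R N alpha j).
Arguments blockE2 : clear implicits.

Definition FW2 (R : realType) (N : nat) (alpha : seq nat) : set 'M[R]_N :=
  [set X | Sym R N X /\
    exists Y : forall i j : 'I_(size alpha),
                 'M[R]_(part alpha i + part alpha j),
      (forall i j : 'I_(size alpha), (i < j)%N -> PSD R _ (Y i j)) /\
      X = \sum_(i < size alpha) \sum_(j < size alpha | (i < j)%N)
            (blockE2 R N alpha i j)^T *m Y i j *m blockE2 R N alpha i j].
Arguments FW2 : clear implicits.

(* enum_val enumerates S : {set 'I_N} in increasing order. *)
Definition selE (R : realType) (N : nat) (S : {set 'I_N}) : 'M[R]_(#|S|, N) :=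
  \matrix_(a < #|S|, b < N) (enum_val a == b)%:R.
Arguments selE : clear implicits.

Definition FW (R : realType) (N k : nat) : set 'M[R]_N :=
  [set X | exists Y : forall S : {set 'I_N}, 'M[R]_#|S|,
      (forall S : {set 'I_N}, #|S| = k -> PSD R _ (Y S)) /\
      X = \sum_(S : {set 'I_N} | #|S| == k)
            (selE R N S)^T *m Y S *m selE R N S].
Arguments FW : clear implicits.

Definition max_pair (alpha : seq nat) : nat :=
  (\max_(i < size alpha) \max_(j < size alpha | j != i)
     (part alpha i + part alpha j))%N.

(* Main.v *)
(* Testing Z against E^T x x^T E shows that the dual of a cone of sums of
   E_i^T Y_i E_i with Y_i psd consists of the Z whose compressions E_i Z E_i^T
   are psd; the converse is self-duality of the psd cone, which follows by writing
   a psd matrix as a sum of rank-one psd matrices. When the rows of E_i are standard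
   basis vectors, that condition says that the quadratic form of Z is nonnegative
   on the vectors supported on a set of coordinates, so each inclusion of duals
   reduces to an inclusion of coordinate sets. *)

Require Import Defs.
From HB Require Import structures.
From mathcomp Require Import all_boot all_order all_algebra.
From mathcomp Require Import all_classical reals.
From mathcomp Require Import ring lra zify.

Set Implicit Arguments.
Unset Strict Implicit.
Unset Printing Implicit Defensive.

Import Order.TTheory GRing.Theory Num.Theory.

Local Open Scope classical_set_scope.
Local Open Scope ring_scope.

(** * Positive semidefinite matrices and self-duality of their cone *)

Lemma SymP (R : realType) n (A : 'M[R]_n) : Sym R n A <-> A^T = A.
Proof.
have mapid (m : nat) (B : 'M[R]_(m, n)) : map_mx idfun B = B.
  by apply/matrixP => i j; rewrite mxE.
rewrite /Sym /=; split.
  by move/is_hermitianmxP; rewrite mapid expr0 scale1r.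
by move=> At; apply/is_hermitianmxP; rewrite mapid expr0 scale1r.
Qed.

Lemma mx11_tr (R : realType) (B : 'M[R]_1) : B^T = B.
Proof. by apply/matrixP => i j; rewrite mxE !ord1. Qed.

Lemma quad_add_scale (R : realType) n (A : 'M[R]_n) (x y : 'cV[R]_n) (c : R) :
  A^T = A ->
  ((x + c *: y)^T *m A *m (x + c *: y)) 0 0 =
  (x^T *m A *m x) 0 0 + 2 * c * (y^T *m A *m x) 0 0 +
  c ^+ 2 * (y^T *m A *m y) 0 0.
Proof.
move=> At.
have xAy : x^T *m A *m y = y^T *m A *m x.
  by rewrite -[LHS]mx11_tr !trmx_mul trmxK At mulmxA.
rewrite [(x + c *: y)^T]linearD /= [(c *: y)^T]linearZ /= !mulmxDl !mulmxDr.
rewrite -!scalemxAl -!scalemxAr xAy.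
rewrite !mxE; ring.
Qed.

Lemma quad_delta (R : realType) n (A : 'M[R]_n) (i j : 'I_n) :
  ((delta_mx i 0 : 'cV_n)^T *m A *m (delta_mx j 0 : 'cV_n)) 0 0 = A i j.
Proof. by rewrite trmx_delta -rowE -colE !mxE. Qed.

Lemma psd_diag_ge0 (R : realType) n (A : 'M[R]_n) i : PSD R n A -> 0 <= A i i.
Proof. by case=> _ /(_ (delta_mx i 0)); rewrite quad_delta. Qed.

(** With a zero diagonal entry at [i], the form at e_j + c e_i is affine in c with slope
    [2 * A i j], so it stays nonnegative for all c only if that slope is 0. *)
Lemma psd_diag_eq0 (R : realType) n (A : 'M[R]_n) i j :
  PSD R n A -> A i i = 0 -> A i j = 0.
Proof.
case=> /SymP At psdA Aii; apply/eqP; apply: contraT => Aij0.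
(* Chosen so that the form takes the value -1. *)
pose c := - (A j j + 1) / (2 * A i j).
have := psdA (delta_mx j 0 + c *: delta_mx i 0).
rewrite quad_add_scale // !quad_delta Aii mulr0 addr0.
suff -> : 2 * c * A i j = - (A j j + 1) by lra.
by rewrite /c; field.
Qed.

(* One step of the Cholesky algorithm. *)
Lemma psd_pivot (R : realType) n (A : 'M[R]_n) i :
  PSD R n A -> A i i != 0 ->
  PSD R n (A - (A i i)^-1 *: ((row i A)^T *m row i A)).
Proof.
move=> psdA Aii0; have [/SymP At qA] := psdA; split.
  by apply/SymP; rewrite linearB linearZ /= trmx_mul trmxK At.
move=> x; set t := (row i A *m x) 0 0.
have rE : (delta_mx i 0 : 'cV[R]_n)^T *m A = row i A by rewrite trmx_delta -rowE.
(* This shift minimises the form of [A] on the line x + s e_i; the minimum is the form of the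
   pivoted matrix at [x]. *)
have := qA (x + (- (A i i)^-1 * t) *: delta_mx i 0).
rewrite quad_add_scale // quad_delta rE -/t.
have -> : x^T *m (A - (A i i)^-1 *: ((row i A)^T *m row i A)) *m x =
    x^T *m A *m x - (A i i)^-1 *: ((row i A *m x)^T *m (row i A *m x)).
  by rewrite mulmxBr mulmxBl -scalemxAr -scalemxAl trmx_mul !mulmxA.
have -> : forall B C : 'M[R]_1, (B - C) 0 0 = B 0 0 - C 0 0.
  by move=> B C; rewrite !mxE.
have -> : forall B : 'M[R]_1, ((A i i)^-1 *: (B^T *m B)) 0 0 =
    (A i i)^-1 * (B 0 0) ^+ 2.
  by move=> B; rewrite !mxE big_ord1 mxE -expr2.
rewrite -/t; congr (0 <= _).
by field.
Qed.

(** Induction on the number of nonzero diagonal entries of [A]. A pivot step splits off a positive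
    multiple of a rank-one matrix, whose trace against [Z] is a value of the form of [Z]. Once the
    diagonal is zero, [A] is zero. *)
Lemma psd_trace_ge0 (R : realType) n (A Z : 'M[R]_n) :
  PSD R n A -> PSD R n Z -> 0 <= \tr (A *m Z).
Proof.
move=> psdA [_ qZ].
have [m] := ubnP #|[pred i | A i i != 0]|; elim: m A psdA => // m IH A psdA le_m.
case: (pickP [pred i | A i i != 0]) => [i /= Aii0 | A0]; last first.
  have -> : A = 0.
    apply/matrixP => i j; rewrite mxE; apply: psd_diag_eq0 => //.
    by apply/eqP; have /negbFE := A0 i.
  by rewrite mul0mx mxtrace0.
set r := row i A; set A' := A - (A i i)^-1 *: (r^T *m r).
have psdA' : PSD R n A' by exact: psd_pivot.
have Aii : 0 < A i i by rewrite lt0r Aii0 psd_diag_ge0.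
have A'E k : A' k k = A k k - (A i i)^-1 * A i k ^+ 2.
  by rewrite !mxE big_ord1 !mxE -expr2.
have trE : \tr (A *m Z) =
    \tr (A' *m Z) + (A i i)^-1 * (r^T^T *m Z *m r^T) 0 0.
  rewrite -{1}(subrK ((A i i)^-1 *: (r^T *m r)) A) mulmxDl mxtraceD.
  rewrite -scalemxAl mxtraceZ -mulmxA (mxtrace_mulC r^T) trmxK.
  by rewrite [\tr (r *m Z *m _)]/mxtrace big_ord1.
rewrite trE addr_ge0 ?mulr_ge0 ?invr_ge0 ?(ltW Aii) ?qZ //.
apply: IH => //; rewrite -ltnS; apply: leq_trans le_m; rewrite ltnS.
(* Pivoting only lowers diagonal entries and keeps them nonnegative, so zeros persist, while entry
   [i] becomes zero. *)
apply/proper_card/properP; split.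
  apply/fintype.subsetP => k; rewrite !inE; apply: contra => /eqP Akk.
  rewrite eq_le psd_diag_ge0 // andbT A'E Akk sub0r oppr_le0.
  by rewrite mulr_ge0 ?invr_ge0 ?(ltW Aii) ?sqr_ge0.
by exists i; rewrite !inE // A'E expr2 mulrA mulVf // mul1r subrr eqxx.
Qed.

Lemma psd_rank1 (R : realType) n (x : 'cV[R]_n) : PSD R n (x *m x^T).
Proof.
split=> [|y]; first by apply/SymP; rewrite trmx_mul trmxK.
have -> : y^T *m (x *m x^T) *m y = (x^T *m y)^T *m (x^T *m y).
  by rewrite trmx_mul trmxK !mulmxA.
by rewrite mxE big_ord1 mxE -expr2 sqr_ge0.
Qed.

Lemma psd_congr (R : realType) m n (E : 'M[R]_(m, n)) (A : 'M[R]_m) :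
  PSD R m A -> PSD R n (E^T *m A *m E).
Proof.
case=> /SymP At qA; split.
  by apply/SymP; rewrite !trmx_mul trmxK At mulmxA.
move=> x; have := qA (E *m x).
by rewrite trmx_mul !mulmxA.
Qed.

(** * Duals of cones generated by congruences *)

(** A common form for [FW2], indexed by pairs of blocks, and [FW], indexed by coordinate sets, so
    that the dual is computed once; the sizes [d i] vary with the index. *)
Definition sum_cone (R : realType) (N : nat) (I : finType) (P : pred I)
    (d : I -> nat) (E : forall i, 'M[R]_(d i, N)) : set 'M[R]_N :=
  [set X | exists Y : forall i, 'M[R]_(d i),
    (forall i, P i -> PSD R _ (Y i)) /\
    X = \sum_(i | P i) (E i)^T *m Y i *m E i].

Lemma sum_cone_congr (R : realType) (N : nat) (I : finType) (P : pred I)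
    (d : I -> nat) (E : forall i, 'M[R]_(d i, N)) i
    (A : 'M[R]_(d i)) : P i -> PSD R _ A ->
  sum_cone P E ((E i)^T *m A *m E i).
Proof.
move=> Pi psdA.
(* conform_mx casts A : 'M_(d i) to 'M_(d j); the junk value 0 is not reached. *)
exists (fun j => if j == i then conform_mx 0 A else 0); split.
  move=> j _; case: eqP => [->|_]; first by rewrite conform_mx_id.
  split=> [|x]; first by apply/SymP; rewrite trmx0.
  by rewrite mulmx0 mul0mx mxE.
rewrite (bigD1 i) //= eqxx conform_mx_id big1 ?addr0 // => j /andP[_ /negPf ->].
by rewrite mulmx0 mul0mx.
Qed.

Lemma dual_sum_cone (R : realType) (N : nat) (I : finType) (P : pred I)
    (d : I -> nat) (E : forall i, 'M[R]_(d i, N)) :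
  dual_cone (sum_cone P E) =
  [set Z | Sym R N Z /\ forall i, P i -> PSD R _ (E i *m Z *m (E i)^T)].
Proof.
apply/seteqP; split=> Z /= [symZ hZ]; split=> //.
  move=> i Pi; have /SymP Zt := symZ; split.
    by apply/SymP; rewrite !trmx_mul trmxK Zt mulmxA.
  (* By cyclicity of the trace, this test matrix returns the form of the compressed [Z] at [x]. *)
  move=> x; have := hZ _ (sum_cone_congr E Pi (psd_rank1 x)).
  have -> : (E i)^T *m (x *m x^T) *m E i *m Z =
      (E i)^T *m x *m (x^T *m E i *m Z) by rewrite !mulmxA.
  rewrite mxtrace_mulC [\tr _]/mxtrace big_ord1.
  by rewrite !mulmxA.
move=> X [Y [psdY ->]]; rewrite mulmx_suml raddf_sum /=.
apply: sumr_ge0 => i Pi.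
(* Grouped so that cyclicity moves [(E i)^T] to the right end, leaving the trace of [Y i] against
   the compression of [Z]. *)
have -> : (E i)^T *m Y i *m E i *m Z = (E i)^T *m (Y i *m (E i *m Z)).
  by rewrite !mulmxA.
rewrite mxtrace_mulC -mulmxA.
by apply: psd_trace_ge0; [exact: psdY | exact: hZ].
Qed.

Lemma FW2_sum_cone (R : realType) N alpha :
  FW2 R N alpha =
  sum_cone (fun p : 'I_(size alpha) * 'I_(size alpha) => (p.1 < p.2)%N)
    (fun p => blockE2 R N alpha p.1 p.2).
Proof.
apply/seteqP; split=> X /=.
  case=> _ [Y [psdY ->]]; exists (fun p => Y p.1 p.2).
  by split; [move=> p; exact: psdY | rewrite pair_big_dep].
case=> Y [psdY XE]; split.
  apply/SymP; rewrite XE linear_sum; apply: eq_bigr => p lt_p /=.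
  by have [/SymP] := psd_congr (blockE2 R N alpha p.1 p.2) (psdY _ lt_p).
exists (fun i j => Y (i, j)); split; first by move=> i j; exact: psdY (i, j).
by rewrite pair_big_dep XE; apply: eq_bigr => -[].
Qed.

Lemma FW_sum_cone (R : realType) N k :
  FW R N k = sum_cone (fun S : {set 'I_N} => #|S| == k) (selE R N).
Proof.
by apply/seteqP; split=> X [Y [psdY XE]]; exists Y; split=> // S /eqP; apply: psdY.
Qed.

Lemma dual_FW2E (R : realType) N alpha :
  dual_cone (FW2 R N alpha) =
  [set Z | Sym R N Z /\ forall i j : 'I_(size alpha), (i < j)%N ->
     PSD R _ (blockE2 R N alpha i j *m Z *m (blockE2 R N alpha i j)^T)].
Proof.
rewrite FW2_sum_cone dual_sum_cone; apply/seteqP; split=> Z [symZ psdZ]; split=> //.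
  by move=> i j; exact: psdZ (i, j).
by case=> i j; exact: psdZ.
Qed.

(** * Compressions as forms on vectors supported in a coordinate set *)

Definition supported (R : realType) N (S : {set 'I_N}) (x : 'cV[R]_N) :=
  forall b, b \notin S -> x b 0 = 0.

(** Says that the principal submatrix on [S] has a nonnegative form, but with test vectors of full
    length [N], so that different [S] can be compared without changing matrix sizes. *)
Definition psd_on (R : realType) N (S : {set 'I_N}) (Z : 'M[R]_N) :=
  forall x : 'cV[R]_N, supported S x -> 0 <= (x^T *m Z *m x) 0 0.

Definition rows_span (R : realType) m N (E : 'M[R]_(m, N)) (S : {set 'I_N}) :=
  forall x : 'cV[R]_N, supported S x <-> exists w, x = E^T *m w.

Lemma psd_onS (R : realType) N (S T : {set 'I_N}) (Z : 'M[R]_N) :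
  S \subset T -> psd_on T Z -> psd_on S Z.
Proof.
move=> /fintype.subsetP sST psdZ x suppx; apply: psdZ => b bT; apply: suppx.
by apply: contra bT; exact: sST.
Qed.

Lemma psd_onT (R : realType) N (Z : 'M[R]_N) :
  Sym R N Z -> psd_on [set: 'I_N]%SET Z <-> PSD R N Z.
Proof.
move=> symZ; split=> [psdZ|[_ psdZ] x _]; last exact: psdZ.
by split=> // x; apply: psdZ => b; rewrite inE.
Qed.

(** The form of [E *m Z *m E^T] at [w] is the form of [Z] at [E^T *m w], and these vectors are
    exactly the ones supported on [S]. *)
Lemma psd_compressP (R : realType) m N (E : 'M[R]_(m, N)) S (Z : 'M[R]_N) :
  rows_span E S -> Sym R N Z -> PSD R m (E *m Z *m E^T) <-> psd_on S Z.
Proof.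
move=> spanE /SymP Zt; split=> [[_ psdZ] x /spanE [w ->]|psdZ].
  by have := psdZ w; rewrite trmx_mul trmxK !mulmxA.
split; first by apply/SymP; rewrite !trmx_mul trmxK Zt mulmxA.
move=> w; have /psdZ : supported S (E^T *m w) by apply/spanE; exists w.
by rewrite trmx_mul trmxK !mulmxA.
Qed.

Lemma rows_span_sel (R : realType) m N (f : 'I_m -> 'I_N) :
  injective f ->
  rows_span (\matrix_(a < m, b < N) (f a == b)%:R : 'M[R]_(m, N))
    [set f a | a in 'I_m]%SET.
Proof.
move=> injf x.
have mulE w b : ((\matrix_(a < m, b < N) (f a == b)%:R : 'M[R]_(m, N))^T *m w) b 0
    = \sum_a (f a == b)%:R * w a 0.
  by rewrite mxE; apply: eq_bigr => a _; rewrite !mxE.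
split=> [suppx|[w ->] b bS]; last first.
  rewrite mulE big1 // => a _.
  by case: eqP bS => [<-|]; [rewrite imset_f | rewrite mul0r].
(* The preimage reads [x] along [f]; injectivity leaves one nonzero coefficient in each sum. *)
exists (\col_a x (f a) 0); apply/colP => b; rewrite mulE.
have [/imsetP[a _ ->]|bS] := boolP (b \in [set f a | a in 'I_m]%SET).
  rewrite (bigD1 a) //= eqxx mul1r mxE big1 ?addr0 // => c ca.
  by rewrite (inj_eq injf) (negPf ca) mul0r.
rewrite suppx // big1 // => a _.
by case: eqP bS => [<-|]; [rewrite imset_f | rewrite mul0r].
Qed.

Lemma rows_span_col (R : realType) m1 m2 N (E : 'M[R]_(m1, N))
    (F : 'M[R]_(m2, N)) S T :
  rows_span E S -> rows_span F T -> rows_span (col_mx E F) (S :|: T).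
Proof.
move=> spanE spanF x; split=> [suppx|[w ->] b].
  (* [y] is the restriction of [x] to [S]; the remainder lives on [T] minus [S], so an overlap of
     [S] and [T] is counted once. *)
  pose y : 'cV[R]_N := \col_b (x b 0 *+ (b \in S)).
  have /spanE [u yE] : supported S y by move=> b /negPf bS; rewrite mxE bS.
  have /spanF [v xyE] : supported T (x - y).
    move=> b /negPf bT; rewrite !mxE.
    have [_|bS] := boolP (b \in S); first by rewrite subrr.
    by rewrite suppx ?subr0 // inE (negPf bS) bT.
  exists (col_mx u v).
  by rewrite tr_col_mx mul_row_col -yE -xyE addrC subrK.
rewrite inE negb_or => /andP[bS bT].
rewrite -[w]vsubmxK tr_col_mx mul_row_col mxE.
have /spanE -> // : exists u, E^T *m usubmx w = E^T *m u by eexists.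
have /spanF -> // : exists u, F^T *m dsubmx w = F^T *m u by eexists.
by rewrite addr0.
Qed.

Lemma rows_span_selE (R : realType) N (S : {set 'I_N}) : rows_span (selE R N S) S.
Proof.
(* [S] also occurs in the type of [selE R N S], so the propositions are equated and only the second
   argument changes. *)
have -> : rows_span (selE R N S) S =
    rows_span (selE R N S) [set enum_val a | a in 'I_#|S|]%SET.
  congr rows_span; apply/setP => b; apply/idP/imsetP => [bS|[a _ ->]].
    by exists (enum_rank_in bS b); rewrite ?enum_rankK_in.
  exact: enum_valP.
exact: rows_span_sel enum_val_inj.
Qed.

Lemma dual_FWP (R : realType) N k (Z : 'M[R]_N) :
  dual_cone (FW R N k) Z <->
  Sym R N Z /\ forall S : {set 'I_N}, #|S| = k -> psd_on S Z.
Proof.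
rewrite FW_sum_cone dual_sum_cone.
split=> -[symZ psdZ]; split=> // S /eqP Sk;
  by apply/(psd_compressP (@rows_span_selE R N S) symZ); exact: psdZ.
Qed.

(** * Blocks of a partition as coordinate intervals *)

Lemma part_offsetS alpha i :
  part_offset alpha i.+1 = (part_offset alpha i + part alpha i)%N.
Proof.
rewrite /part_offset /part; have [lti|gei] := ltnP i (size alpha).
  by rewrite (take_nth 0%N) // sumn_rcons.
(* Past the end, the part is the default 0 and the offset stays at the full sum. *)
by rewrite nth_default // !take_oversize ?addn0 // ltnW.
Qed.

Lemma part_offsetE alpha i :
  part_offset alpha i = (\sum_(0 <= j < i) part alpha j)%N.
Proof.
elim: i => [|i IH]; first by rewrite big_geq // /part_offset take0.
by rewrite part_offsetS IH big_nat_recr.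
Qed.

Lemma leq_part_offset alpha i j :
  (i <= j)%N -> (part_offset alpha i <= part_offset alpha j)%N.
Proof.
move=> le_ij; rewrite !part_offsetE (@big_cat_nat _ _ _ i 0%N j) //=.
exact: leq_addr.
Qed.

Lemma part_offset_size alpha : part_offset alpha (size alpha) = sumn alpha.
Proof. by rewrite /part_offset take_size. Qed.

Definition block N alpha i : {set 'I_N} :=
  [set b : 'I_N | (part_offset alpha i <= b < part_offset alpha i.+1)%N]%SET.
Arguments block : clear implicits.

Lemma block_cover N alpha (b : 'I_N) :
  is_partition N alpha -> exists i : 'I_(size alpha), b \in block N alpha i.
Proof.
move=> [_ alphaN].
suff [i ltis bi] : exists2 i, (i < size alpha)%N &
    (part_offset alpha i <= b < part_offset alpha i.+1)%N.
  by exists (Ordinal ltis); rewrite inE.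
have : (b < part_offset alpha (size alpha))%N by rewrite part_offset_size alphaN.
(* Offsets run from 0 to [N]; the induction finds consecutive ones that enclose [b]. *)
elim: (size alpha) => [|n IH]; first by rewrite /part_offset take0.
move=> ltb; have [/IH[i ltin bi]|le_b] := ltnP b (part_offset alpha n).
  by exists i => //; exact: ltnW.
by exists n => //; rewrite le_b.
Qed.

(** The map [f] matches row [a] of [blockE] with its coordinate; it yields both the row span and the
    size of the block. *)
Lemma block_imset N alpha (i : 'I_(size alpha)) :
  is_partition N alpha ->
  exists f : 'I_(part alpha i) -> 'I_N,
    [/\ injective f, block N alpha i = [set f a | a in 'I_(part alpha i)]%SET &
        forall a, f a = (part_offset alpha i + a)%N :> nat].
Proof.
move=> [_ alphaN].
have ltN (a : 'I_(part alpha i)) : (part_offset alpha i + a < N)%N.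
  have := leq_part_offset alpha (ltn_ord i).
  rewrite part_offset_size alphaN part_offsetS; apply: leq_trans.
  by rewrite ltn_add2l.
exists (fun a => Ordinal (ltN a)); split.
- by move=> a c [] /addnI /val_inj.
- apply/setP => b; rewrite inE part_offsetS; apply/idP/imsetP; last first.
    by case=> a _ -> /=; rewrite leq_addr ltn_add2l ltn_ord.
  case/andP=> le_b lt_b.
  have lta : (b - part_offset alpha i < part alpha i)%N by lia.
  by exists (Ordinal lta) => //; apply: val_inj => /=; rewrite subnKC.
- by [].
Qed.

Lemma card_block N alpha (i : 'I_(size alpha)) :
  is_partition N alpha -> #|block N alpha i| = part alpha i.
Proof.
by move=> /(block_imset i)[f [injf -> _]]; rewrite card_imset // card_ord.
Qed.

Lemma rows_span_blockE (R : realType) N alpha (i : 'I_(size alpha)) :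
  is_partition N alpha -> rows_span (blockE R N alpha i) (block N alpha i).
Proof.
move=> /(block_imset i)[f [injf -> fE]].
have -> : blockE R N alpha i = \matrix_(a, b) (f a == b)%:R.
  by apply/matrixP => a b; rewrite !mxE -fE val_eqE.
exact: rows_span_sel.
Qed.

Lemma rows_span_blockE2 (R : realType) N alpha (i j : 'I_(size alpha)) :
  is_partition N alpha ->
  rows_span (blockE2 R N alpha i j) (block N alpha i :|: block N alpha j).
Proof.
by move=> alphaN; apply: rows_span_col; exact: rows_span_blockE.
Qed.

Lemma dual_FW2P (R : realType) N alpha (Z : 'M[R]_N) :
  is_partition N alpha ->
  dual_cone (FW2 R N alpha) Z <->
  Sym R N Z /\ forall i j : 'I_(size alpha), i != j ->
    psd_on (block N alpha i :|: block N alpha j) Z.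
Proof.
move=> alphaN; rewrite dual_FW2E; split=> -[symZ psdZ]; split=> // i j ij.
  (* The union of two blocks is symmetric in them, so [i != j] may replace [i < j]. *)
  wlog lt_ij : i j ij / (i < j)%N.
    move=> H; have [lt_ij|lt_ji|/val_inj eq_ij] := ltngtP i j; first exact: H.
      by rewrite finset.setUC; apply: H; rewrite // eq_sym.
    by rewrite eq_ij eqxx in ij.
  have spanE := @rows_span_blockE2 R N alpha i j alphaN.
  by apply/(psd_compressP spanE symZ); exact: psdZ.
have spanE := @rows_span_blockE2 R N alpha i j alphaN.
apply/(psd_compressP spanE symZ); apply: psdZ.
by rewrite -val_eqE neq_ltn ij.
Qed.

(** * Inclusions between the duals *)

(** Two blocks of [beta] lie in the union of two distinct blocks of [alpha]. If both lie in the same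
    block [i], any other block serves as the second; it exists because [alpha] has at least two. *)
Lemma dual_FW2_refine (R : realType) N alpha beta :
  is_partition N alpha -> is_partition N beta -> (2 <= size alpha)%N ->
  (forall c : 'I_(size beta), exists i : 'I_(size alpha),
     block N beta c \subset block N alpha i) ->
  dual_cone (FW2 R N alpha) `<=` dual_cone (FW2 R N beta).
Proof.
move=> alphaN betaN alpha_ge2 refine Z /(dual_FW2P _ alphaN)[symZ psdZ].
apply/(dual_FW2P _ betaN); split=> // c c' _.
have [[i si] [i' si']] := (refine c, refine c').
have [eq_ii'|ne_ii'] := eqVneq i i'; last first.
  by apply: psd_onS _ (psdZ _ _ ne_ii'); exact: finset.setUSS.
have [j ne_ij] : exists j : 'I_(size alpha), i != j.
  have /card_gt0P[j] : (0 < #|[set~ i]%SET|)%N by rewrite cardsC1 card_ord; lia.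
  by rewrite !inE eq_sym; exists j.
have sT : block N beta c :|: block N beta c' \subset
    block N alpha i :|: block N alpha j.
  apply/finset.subUsetP; rewrite eq_ii' in si *.
  split; first exact: fintype.subset_trans si (finset.subsetUl _ _).
  exact: fintype.subset_trans si' (finset.subsetUl _ _).
exact: psd_onS sT (psdZ _ _ ne_ij).
Qed.

Lemma part_ones_partition N : is_partition N (part_ones N).
Proof. by split; rewrite ?sumn_nseq ?mul1n // all_nseq orbT. Qed.

Lemma part_offset_ones N i : (i <= N)%N -> part_offset (part_ones N) i = i.
Proof. by move=> leiN; rewrite /part_offset take_nseq // sumn_nseq mul1n. Qed.

Lemma block_ones N beta (c : 'I_(size (part_ones N))) :
  is_partition N beta -> exists i : 'I_(size beta),
    block N (part_ones N) c \subset block N beta i.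
Proof.
move=> betaN; have ltcN : (c < N)%N by rewrite -[X in (_ < X)%N](size_nseq N 1%N).
have [i ci] := block_cover (Ordinal ltcN) betaN; exists i.
apply/fintype.subsetP => b.
rewrite inE !part_offset_ones ?(ltnW ltcN) // => bc.
(* Block [c] of the partition into ones is the singleton of coordinate [c]. *)
suff -> : b = Ordinal ltcN by [].
by apply: val_inj => /=; lia.
Qed.

Lemma block_subpartition N alpha beta (c : 'I_(size beta)) :
  is_subpartition alpha beta -> exists i : 'I_(size alpha),
    block N beta c \subset block N alpha i.
Proof.
move=> [_ [m [m0 mp mS alphaE]]].
(* Adding up the parts of [beta] between cut points shows that every boundary of [alpha] is a
   boundary of [beta]. *)
have offE i : (i <= size alpha)%N -> part_offset alpha i = part_offset beta (m i).
  elim: i => [|i IH] ltis; first by rewrite m0 /part_offset !take0.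
  rewrite part_offsetS IH 1?ltnW // alphaE // !part_offsetE.
  by rewrite -big_cat_nat //= ltnW // mS.
(* The block of [alpha] containing block [c] is given by the cut points around [c]. *)
have [i ltis /andP[le_c lt_c]] : exists2 i, (i < size alpha)%N &
    (m i <= c < m i.+1)%N.
  have : (c < m (size alpha))%N by rewrite mp ltn_ord.
  elim: (size alpha) => [|n IH]; first by rewrite m0.
  move=> lt_c; have [/IH[i ltin ci]|le_c] := ltnP c (m n).
    by exists i => //; exact: ltnW.
  by exists n => //; rewrite le_c.
exists (Ordinal ltis); apply/fintype.subsetP => b; rewrite !inE /= => /andP[le_b lt_b].
rewrite (offE i (ltnW ltis)) (offE i.+1 ltis); apply/andP; split.
  by apply: leq_trans le_b; exact: leq_part_offset.
by apply: leq_trans lt_b _; exact: leq_part_offset.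
Qed.

(** Two distinct parts are two terms of the sum [N]. The bound leaves room to enlarge a union of two
    blocks to [max_pair alpha] coordinates. *)
Lemma max_pair_le N alpha : is_partition N alpha -> (max_pair alpha <= N)%N.
Proof.
move=> [_ <-]; apply/bigmax_leqP => i _; apply/bigmax_leqP => j ji.
rewrite -part_offset_size part_offsetE big_mkord (bigD1 i) //= (bigD1 j) //=.
by rewrite leq_add2l leq_addr.
Qed.

Lemma superset_of_card N (S : {set 'I_N}) k : (#|S| <= k <= N)%N ->
  exists2 T : {set 'I_N}, S \subset T & #|T| = k.
Proof.
(* Induction on the number of elements still to be added. *)
move=> /andP[/subnK <-]; elim: (k - _)%N => [|n IH] leN; first by exists S.
have [T sST cardT] := IH (ltnW leN).
have /card_gt0P[x] : (0 < #|~: T|)%N.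
  by rewrite cardsCs finset.setCK card_ord subn_gt0 cardT.
rewrite inE => xT; exists (x |: T); last by rewrite cardsU1 xT cardT.
exact: fintype.subset_trans sST (finset.subsetUr _ _).
Qed.

(** A union of two blocks has at most [max_pair alpha] elements, while the dual of [FW] tests sets
    of exactly that size; hence the union is first enlarged. *)
Lemma dual_FW_max_pair (R : realType) N alpha :
  is_partition N alpha ->
  dual_cone (FW R N (max_pair alpha)) `<=` dual_cone (FW2 R N alpha).
Proof.
move=> alphaN Z /dual_FWP[symZ psdZ]; apply/(dual_FW2P _ alphaN); split=> // i j ij.
suff [T sT cardT] : exists2 T : {set 'I_N},
    block N alpha i :|: block N alpha j \subset T & #|T| = max_pair alpha.
  exact: psd_onS sT (psdZ _ cardT).
apply: superset_of_card; rewrite max_pair_le // andbT.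
apply: leq_trans (leq_card_setU _ _) _; rewrite !card_block //.
rewrite /max_pair (bigD1 i) //= leq_max; apply/orP; left.
by apply: leq_bigmax_cond; rewrite eq_sym.
Qed.

(** The only pair of blocks covers all coordinates, so its condition is semidefiniteness of [Z]
    itself. *)
Lemma dual_FW2_two_blocks (R : realType) N K1 K2 :
  (0 < K1)%N -> (0 < K2)%N -> (K1 + K2)%N = N ->
  dual_cone (FW2 R N [:: K1; K2]) = PSD R N.
Proof.
move=> K1_gt0 K2_gt0 KN.
have KN2 : is_partition N [:: K1; K2].
  by split; rewrite /= ?K1_gt0 ?K2_gt0 // addn0.
have cover : block N [:: K1; K2] 0 :|: block N [:: K1; K2] 1 = [set: 'I_N]%SET.
  apply/setP => b; rewrite !inE /part_offset /= !addn0 KN ltn_ord andbT.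
  exact: leqVgt.
apply/seteqP; split=> Z.
  move=> /(dual_FW2P _ KN2)[symZ psdZ]; apply/psd_onT => //.
  by rewrite -cover; exact: psdZ (@Ordinal 2 0 isT) (@Ordinal 2 1 isT) isT.
move=> psdZ; have [symZ _] := psdZ; apply/(dual_FW2P _ KN2); split=> // i j _.
by apply: psd_onS (finset.subsetT _) _; apply/psd_onT.
Qed.

Theorem corollary1 (R : realType) (N : nat) (alpha : seq nat)
    (alphaN : is_partition N alpha) (alpha_ge2 : (2 <= size alpha)%N) :
  dual_cone (FW2 R N alpha) =
    [set Z | Sym R N Z /\ forall i j : 'I_(size alpha), (i < j)%N ->
       PSD R _ (blockE2 R N alpha i j *m Z *m (blockE2 R N alpha i j)^T)]
  /\
  (forall (beta : seq nat) (K1 K2 : nat),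
     is_partition N beta -> is_subpartition alpha beta ->
     (0 < K1)%N -> (0 < K2)%N -> (K1 + K2)%N = N ->
     [/\ dual_cone (FW2 R N beta) `<=` dual_cone (FW2 R N (part_ones N)),
         dual_cone (FW2 R N alpha) `<=` dual_cone (FW2 R N beta),
         dual_cone (FW R N (max_pair alpha)) `<=` dual_cone (FW2 R N alpha),
         dual_cone (FW2 R N [:: K1; K2]) `<=` dual_cone (FW R N (max_pair alpha))
       & dual_cone (FW2 R N [:: K1; K2]) = PSD R N]).
Proof.
split; first exact: dual_FW2E.
move=> beta K1 K2 betaN sub_ab K1_gt0 K2_gt0 KN.
have [lt_size _] := sub_ab.
split.
- apply: dual_FW2_refine => //; first exact: part_ones_partition.
    exact: leq_trans alpha_ge2 (ltnW lt_size).
  by move=> c; exact: block_ones.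
- by apply: dual_FW2_refine => // c; exact: block_subpartition.
- exact: dual_FW_max_pair.
(* A form nonnegative on all vectors is nonnegative on those supported in any [S]. *)
- rewrite dual_FW2_two_blocks // => Z psdZ; have [symZ _] := psdZ.
  apply/dual_FWP; split=> // S _.
  by apply: psd_onS (finset.subsetT _) _; apply/psd_onT.
- exact: dual_FW2_two_blocks.
Qed.
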